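(* Let $A_a, A_b, A_c$ be the three automorphisms of the rooted binary tree $\{0,1\}^*$ defined by the first Aleshin automaton, i.e. the maps $\{0,1\}^*\to\{0,1\}^*$ determined by $A_q(\varnothing)=\varnothing$ for $q\in\{a,b,c\}$ and, for all $w\in\{0,1\}^*$, $$A_a(0w)=1A_c(w),\quad A_a(1w)=0A_b(w),$$ $$A_b(0w)=1A_b(w),\quad A_b(1w)=0A_c(w),$$ $$A_c(0w)=0A_a(w),\quad A_c(1w)=1A_a(w).$$ Then $A_a, A_b, A_c$ generate (under composition) a free group of transformations on three generators.
   Context: $\{0,1\}^*$ is the set of finite words over $\{0,1\}$, including the empty word $\varnothing$, viewed as a rooted binary tree with root $\varnothing$ in which $w$ is joined to $w0$ and $w1$. The first Aleshin automaton is the automaton $(Q,X,\phi,\psi)$ with alphabet $X=\{0,1\}$, states $Q=\{a,b,c\}$, transition function $\phi(a,0)=\phi(b,1)=c$, $\phi(a,1)=\phi(b,0)=b$, $\phi(c,0)=\phi(c,1)=a$, and output function $\psi(a,0)=\psi(b,0)=\psi(c,1)=1$, $\psi(a,1)=\psi(b,1)=\psi(c,0)=0$. The transformation defined by a state $q$ satisfies $A_q(xw)=\psi(q,x)A_{\phi(q,x)}(w)$ for $x\in X$, $w\in X^*$. Each $A_q$ is a bijection and an automorphism of the rooted tree. *)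

(* Defs.v *)
From HB Require Import structures.
From mathcomp Require Import all_boot.
From mathcomp Require Import boolp.

Set Implicit Arguments.
Unset Strict Implicit.
Unset Printing Implicit Defensive.

Local Open Scope group_scope.

(* The letters 0 and 1 are the booleans false and true. *)
Definition word := seq bool.

Definition adjacent (u v : word) : Prop :=
  exists x : bool, v = rcons u x \/ u = rcons v x.

Record tree_aut := TreeAut {
  aut_fun :> word -> word;
  aut_bij : bijective aut_fun;
  aut_root : aut_fun [::] = [::];
  aut_adj : forall u v, adjacent (aut_fun u) (aut_fun v) <-> adjacent u v
}.

HB.instance Definition _ := gen_eqMixin tree_aut.
HB.instance Definition _ := gen_choiceMixin tree_aut.

Lemma tree_aut_ext (f g : tree_aut) : f =1 g -> f = g.
Proof.
case: f g => [f f1 f2 f3] [g g1 g2 g3] /= /funext fg.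
rewrite -{}fg in g1 g2 g3 *.
by congr TreeAut; apply: Prop_irrelevance.
Qed.

Section TreeAutGroup.
Implicit Types f g h : tree_aut.

Definition tree_aut_one : tree_aut.
Proof. by exists id => //; exists id. Defined.

Definition tree_aut_mul f g : tree_aut.
Proof.
exists (f \o g).
- exact: bij_comp (aut_bij f) (aut_bij g).
- by rewrite /= !aut_root.
- by move=> u v /=; rewrite !aut_adj.
Defined.

Lemma tree_aut_inv_ex f : {g : tree_aut | cancel f g & cancel g f}.
Proof.
apply: cid2.
have [g fK gK] := aut_bij f.
have gB : bijective g by exists f.
have g0 : g [::] = [::] by rewrite -{1}(aut_root f) fK.
have gA u v : adjacent (g u) (g v) <-> adjacent u v.
  by rewrite -(aut_adj f) !gK.
by exists (TreeAut gB g0 gA).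
Qed.

Definition tree_aut_inv f : tree_aut := s2val (tree_aut_inv_ex f).

Lemma tree_autK f : cancel f (tree_aut_inv f).
Proof. exact: s2valP (tree_aut_inv_ex f). Qed.

Lemma tree_autVK f : cancel (tree_aut_inv f) f.
Proof. exact: s2valP' (tree_aut_inv_ex f). Qed.

Lemma tree_aut_mulA : associative tree_aut_mul.
Proof. by move=> f g h; apply: tree_aut_ext. Qed.

Lemma tree_aut_mul1g : left_id tree_aut_one tree_aut_mul.
Proof. by move=> f; apply: tree_aut_ext. Qed.

Lemma tree_aut_mulg1 : right_id tree_aut_one tree_aut_mul.
Proof. by move=> f; apply: tree_aut_ext. Qed.

Lemma tree_aut_mulVg : left_inverse tree_aut_one tree_aut_inv tree_aut_mul.
Proof. by move=> f; apply: tree_aut_ext => w; exact: tree_autK. Qed.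

Lemma tree_aut_mulgV : right_inverse tree_aut_one tree_aut_inv tree_aut_mul.
Proof. by move=> f; apply: tree_aut_ext => w; exact: tree_autVK. Qed.

End TreeAutGroup.

HB.instance Definition _ := isGroup.Build tree_aut
  tree_aut_mulA tree_aut_mul1g tree_aut_mulg1 tree_aut_mulVg tree_aut_mulgV.

Section Generated.
Variables (G : groupType) (I : Type) (x : I -> G).

Definition in_generated : {pred G} := fun g =>
  `[< forall S : {pred G}, group_closed S -> (forall i, x i \in S) -> g \in S >].

Record generated := Generated {
  generated_val :> G;
  generated_valP : generated_val \in in_generated
}.

HB.instance Definition _ := [isSub for generated_val].
HB.instance Definition _ := [Choice of generated by <:].

Lemma in_generated_closed : group_closed in_generated.
Proof.
split; first by apply/asboolP => S [].
move=> u v /asboolP gu /asboolP gv; apply/asboolP => S SG Sx.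
by apply: (proj2 SG); [exact: gu | exact: gv].
Qed.

HB.instance Definition _ :=
  SubChoice_isSubGroup.Build G in_generated generated in_generated_closed.

Lemma generator_subproof i : x i \in in_generated.
Proof. by apply/asboolP => S _; apply. Qed.

Definition generator (i : I) : generated := Generated (generator_subproof i).

End Generated.

(* The universal property of the free group G with free generators x i; since
   H is arbitrary, it forces the x i to be pairwise distinct. *)
Definition free_group_on (G : groupType) (I : Type) (x : I -> G) : Prop :=
  forall (H : groupType) (f : I -> H),
    exists2 phi : {multiplicative G -> H}, forall i, phi (x i) = f i
      & forall psi : {multiplicative G -> H},
          (forall i, psi (x i) = f i) -> psi =1 phi.

Definition freely_generate (G : groupType) (I : Type) (x : I -> G) : Prop :=
  free_group_on (generator x).

Record automaton (Q X : Type) := Automaton {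
  transition : Q -> X -> Q;
  output : Q -> X -> X
}.

Fixpoint transformation (Q X : Type) (M : automaton Q X) (q : Q) (w : seq X) :
    seq X :=
  if w is x :: w' then output M q x :: transformation M (transition M q x) w'
  else [::].

Variant aleshin_state := Qa | Qb | Qc.

Definition aleshin : automaton aleshin_state bool := {|
  transition q x :=
    match q, x with
    | Qa, false => Qc | Qa, true => Qb
    | Qb, false => Qb | Qb, true => Qc
    | Qc, _ => Qa
    end;
  output q x :=
    match q with
    | Qa | Qb => ~~ x
    | Qc => x
    end
|}.

Definition aleshin_map : aleshin_state -> word -> word := transformation aleshin.

Lemma aleshin_mapE (w : word) :
  [/\ aleshin_map Qa (false :: w) = true :: aleshin_map Qc w
    & aleshin_map Qa (true :: w) = false :: aleshin_map Qb w] /\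
  [/\ aleshin_map Qb (false :: w) = true :: aleshin_map Qb w
    & aleshin_map Qb (true :: w) = false :: aleshin_map Qc w] /\
  [/\ aleshin_map Qc (false :: w) = false :: aleshin_map Qa w
    & aleshin_map Qc (true :: w) = true :: aleshin_map Qa w].
Proof. by []. Qed.

Lemma aleshin_map_inj q : injective (aleshin_map q).
Proof.
move=> u v; elim: u v q => [|x u IHu] [|y v] q //= [].
by case: q x y => [] [] [] //= _ /IHu ->.
Qed.

Lemma aleshin_map_surj q v : exists u, aleshin_map q u = v.
Proof.
elim: v q => [|y v IHv] q; first by exists [::].
have [u uv] := IHv (transition aleshin q (output aleshin q y)).
exists (output aleshin q y :: u); rewrite /= -[X in _ = _ :: X]uv.
by case: q {uv} y => [] [].
Qed.

Lemma aleshin_map_bij q : bijective (aleshin_map q).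
Proof.
have [g gK] := choice (aleshin_map_surj q).
by exists g => // w; apply: (@aleshin_map_inj q); apply: gK.
Qed.

Lemma aleshin_map_rcons q u x :
  exists y, aleshin_map q (rcons u x) = rcons (aleshin_map q u) y.
Proof.
elim: u q => [|z u IHu] q; first by exists (output aleshin q x).
by have [y uy] := IHu (transition aleshin q z); exists y; congr cons.
Qed.

Lemma aleshin_map_rcons_inv q u v y :
  aleshin_map q v = rcons (aleshin_map q u) y -> exists x, v = rcons u x.
Proof.
elim: u v q => [|z u IHu] [|t v] q //=.
  by case: v => // _; exists t.
case=> zt; have -> : t = z by case: q t z zt => [] [] [].
by move=> /IHu[x ->]; exists x.
Qed.

Lemma aleshin_map_adj q u v :
  adjacent (aleshin_map q u) (aleshin_map q v) <-> adjacent u v.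
Proof.
split=> -[x].
  by case=> /aleshin_map_rcons_inv[y ->]; exists y; [left | right].
case=> ->.
  by have [y ->] := aleshin_map_rcons q u x; exists y; left.
by have [y ->] := aleshin_map_rcons q v x; exists y; right.
Qed.

Definition aleshin_aut (q : aleshin_state) : tree_aut :=
  TreeAut (aleshin_map_bij q) (erefl : aleshin_map q [::] = [::])
    (@aleshin_map_adj q).

(* Main.v *)
(* A group word over a, b, c acts on the tree, and its section at the bit [z] is
   another word, [residue z u], with the same exponent signs and reduced if [u]
   is. If [u] is trivial, so are all words in its orbit under the two residue
   maps. Up to relabelling by S_3, these maps amount to involutions that swap a
   and b at the positions where an automaton counting the letters a and b is in
   an odd state. This makes it possible to show, by induction on the length, that
   all reduced words with a given pattern of signs lie in one orbit: one fixes a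
   prefix by such an involution that moves the last letter. Since some word with
   the pattern has an odd number of letters a and b, hence flips the first bit,
   no nonempty reduced word is trivial. *)
Require Import Defs.
From mathcomp Require Import all_boot.
From HB Require Import structures.
From mathcomp Require Import boolp.
From Stdlib Require Import Relation_Operators.

Set Implicit Arguments.
Unset Strict Implicit.
Unset Printing Implicit Defensive.

Local Open Scope group_scope.

(** * Group words *)

Section GroupWords.
Variable I : eqType.
Implicit Types (l m : I * bool) (u v : seq (I * bool)).

(* [(i, false)] stands for the generator [i] and [(i, true)] for its inverse. *)
Definition eval_letter (G : groupType) (x : I -> G) l : G :=
  if l.2 then (x l.1)^-1 else x l.1.

(* The head letter is the rightmost factor: maps compose from the right, so
   this is the order in which the letters act. *)
Fixpoint eval (G : groupType) (x : I -> G) u : G :=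
  if u is l :: u' then eval x u' * eval_letter x l else 1.

Definition composable l m := (l.2 == m.2) || (l.1 != m.1).

Definition reduced u := sorted composable u.

Definition inverse_word u := rev [seq (l.1, ~~ l.2) | l <- u].

Lemma eval_cat (G : groupType) (x : I -> G) u v :
  eval x (u ++ v) = eval x v * eval x u.
Proof. by elim: u => [|l u IHu] /=; rewrite ?mulg1 // IHu mulgA. Qed.

Lemma eval_inverse (G : groupType) (x : I -> G) u :
  eval x (inverse_word u) = (eval x u)^-1.
Proof.
rewrite /inverse_word; elim: u => [|l u IHu] /=; first by rewrite invg1.
rewrite rev_cons -cats1 eval_cat IHu /= mul1g invgM; congr (_ * _).
by rewrite /eval_letter /=; case: l.2; rewrite ?invgK.
Qed.

Lemma eval_morph (G H : groupType) (phi : {multiplicative G -> H})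
    (x : I -> G) u :
  phi (eval x u) = eval (phi \o x) u.
Proof.
have phi1 : phi 1 = 1 by apply: (mulgI (phi 1)); rewrite -gmulfM !mulg1.
elim: u => [//|l u IHu] /=; rewrite gmulfM IHu; congr (_ * _).
rewrite /eval_letter; case: l.2 => //=.
by apply/esym/mulg1_eq; rewrite -gmulfM mulgV.
Qed.

Lemma not_reduced_cancel u : ~~ reduced u ->
  exists u1 u2 l, u = u1 ++ l :: (l.1, ~~ l.2) :: u2.
Proof.
rewrite /reduced; elim: u => [//|l [//|m u] IHu] /=.
rewrite negb_and => /orP[|/IHu[u1 [u2 [k ->]]]]; last by exists (l :: u1), u2, k.
rewrite negb_or negbK => /andP[lm /eqP e].
exists [::], u, l; congr [:: _, _ & _].
by case: l m e lm {IHu} => i [] [j []] /= ->.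
Qed.

(** Words trivial in [G] cancel down to the empty word, hence are trivial in every group; so
    [eval f] of a word depends only on its value in [G]. *)
Lemma freely_generate_reduced (G : groupType) (x : I -> G) :
    (forall u, reduced u -> u != [::] -> eval x u <> 1) ->
  freely_generate x.
Proof.
move=> x_free H f.
have eval1 n u : size u <= n -> eval x u = 1 -> eval f u = 1.
  elim: n u => [|n IHn] u; first by rewrite leqn0 => /nilP->.
  have [u_red|/not_reduced_cancel[u1 [u2 [l ->]]]] := boolP (reduced u).
    by have [->|u0] := eqVneq u [::] => // _ /(x_free u u_red u0).
  have cancel (K : groupType) (y : I -> K) :
      @eval K y (u1 ++ l :: (l.1, ~~ l.2) :: u2) = eval y (u1 ++ u2).
    rewrite !eval_cat /= -(mulgA (eval y u2)) /eval_letter /=.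
    by case: l.2; rewrite /= ?mulgV ?mulVg mulg1.
  rewrite !cancel => le_n; apply: IHn.
  by move: le_n; rewrite !size_cat /= !addnS ltnS => /ltnW.
have eval_eq u v : eval x u = eval x v -> eval f u = eval f v.
  move=> uv; apply: divg1_eq; rewrite -eval_inverse -eval_cat.
  by apply: eval1 (leqnn _) _; rewrite eval_cat eval_inverse uv mulgV.
have word_of (g : generated x) : {u | eval x u = val g}.
  apply: cid; have /asboolP gP := valP g.
  have := gP (fun h => `[< exists u, eval x u = h >]).
  case/(_ _ _)/asboolP => [||u ug]; last by exists u.
    split; first by apply/asboolP; exists [::].
    move=> _ _ /asboolP[u <-] /asboolP[v <-]; apply/asboolP.
    by exists (inverse_word v ++ u); rewrite eval_cat eval_inverse.
  by move=> i; apply/asboolP; exists [:: (i, false)]; rewrite /= mul1g.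
pose phi g := eval f (sval (word_of g)).
have phiM : {morph phi : g h / g * h}.
  move=> g h; rewrite /phi -eval_cat; apply: eval_eq.
  rewrite eval_cat (svalP (word_of (g * h))).
  by rewrite (svalP (word_of g)) (svalP (word_of h)).
pose phi_mor := isMultiplicative.Build (generated x) H phi phiM.
pose Phi : {multiplicative generated x -> H} := HB.pack phi phi_mor.
have phi_gen i : phi (generator x i) = f i.
  rewrite /phi; have -> : f i = eval f [:: (i, false)] by rewrite /= mul1g.
  by apply: eval_eq; rewrite (svalP (word_of _)) /= mul1g.
exists Phi => [//|psi psi_f g].
have -> : g = eval (generator x) (sval (word_of g)).
  apply: val_inj; rewrite -[LHS](svalP (word_of g)).
  exact/esym/(eval_morph (val : {multiplicative _ -> _})).
rewrite !eval_morph; congr (eval _ _); apply/funext => i /=.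
by rewrite psi_f phi_gen.
Qed.

End GroupWords.

(** * The dual automaton *)

Definition code_state (q : aleshin_state) : option bool :=
  match q with Qa => Some false | Qb => Some true | Qc => None end.

Definition decode_state (c : option bool) : aleshin_state :=
  match c with Some false => Qa | Some true => Qb | None => Qc end.

Lemma code_stateK : cancel code_state decode_state.
Proof. by case. Qed.

HB.instance Definition _ := Finite.copy aleshin_state (can_type code_stateK).

Notation letter := (aleshin_state * bool)%type.

Implicit Types (q p : aleshin_state) (l : letter) (u v : seq letter).

(* The action of [A_q^e] on the first bit [z]; it does not depend on the sign. *)
Definition leave z l := output aleshin l.1 z.

(** The inverse of [A_q] reads the bit that [A_q] writes: for [Qa] and [Qb] this negates the bit
    seen by the transition, and for [Qc] the transition ignores it. *)
Definition section z l : letter := (transition aleshin l.1 (z (+) l.2), l.2).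

Definition leave_word z u := foldl leave z u.

Fixpoint residue z u : seq letter :=
  if u is l :: u' then section z l :: residue (leave z l) u' else [::].

Notation aleshin_eval := (eval aleshin_aut).

Lemma eval_letter_cons l z w :
  eval_letter aleshin_aut l (z :: w)
    = leave z l :: eval_letter aleshin_aut (section z l) w.
Proof.
case: l => q []; rewrite /eval_letter /= ?addbF //.
have transfK p s : transformation aleshin p (tree_aut_inv (aleshin_aut p) s) = s.
  exact: (tree_autVK (aleshin_aut p)).
apply: (can_inj (tree_autK (aleshin_aut q))).
rewrite [LHS](tree_autVK (aleshin_aut q)) /=.
by case: q z => [] [] /=; congr (_ :: _); exact/esym/transfK.
Qed.

Lemma eval_cons u z w :
  aleshin_eval u (z :: w)
    = leave_word z u :: aleshin_eval (residue z u) w.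
Proof.
elim: u z w => [//|l u IHu] z w /=.
by rewrite -/(eval_letter _ _) /= eval_letter_cons IHu.
Qed.

Lemma size_residue z u : size (residue z u) = size u.
Proof. by elim: u z => //= l u IHu z; rewrite IHu. Qed.

Lemma residue_inj z : injective (residue z).
Proof.
move=> u v; elim: u v z => [|[q d] u IHu] [|[p e] v] z //= [qp de].
rewrite -{}de in qp *; have -> : q = p by case: q p z d qp => [] [] [] [].
by move=> /IHu->.
Qed.

(** [residue z] permutes the finite set of words of a given length, so forward steps alone lead back
    to [u]. *)
Lemma residue_periodic z u : exists n, iter n (residue z) (residue z u) = u.
Proof.
have sz (t : (size u).-tuple letter) : size (residue z t) == size u.
  by rewrite size_residue size_tuple.
pose f t := Tuple (sz t).
have f_inj : injective f.
  by move=> s t /(congr1 val) /residue_inj /val_inj.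
have val_iter n t : val (iter n f t) = iter n (residue z) (val t).
  by elim: n => //= n ->.
exists (order f (in_tuple u)).-1; have := iter_order f_inj (in_tuple u).
by rewrite -orderSpred iterSr => /(congr1 val); rewrite val_iter.
Qed.

Lemma residue_surj z v : exists u, residue z u = v.
Proof.
have [n <-] := residue_periodic z v.
by exists (iter n (residue z) v); rewrite -iterS iterSr.
Qed.

Lemma eval_residue z u : aleshin_eval u = 1 <-> aleshin_eval (residue z u) = 1.
Proof.
have residue1 v : aleshin_eval v = 1 -> aleshin_eval (residue z v) = 1.
  move=> v1; apply: tree_aut_ext => w.
  by have := eval_cons v z w; rewrite v1 => -[_ /esym].
split=> [|ru1]; first exact: residue1.
by have [n <-] := residue_periodic z u; elim: n => //= n /residue1.
Qed.

Definition dual_step u v := exists z, v = residue z u.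

Definition dual_orbit := clos_refl_sym_trans (seq letter) dual_step.

Lemma orbit_refl u : dual_orbit u u. Proof. exact: rst_refl. Qed.

Lemma orbit_sym u v : dual_orbit u v -> dual_orbit v u.
Proof. exact: rst_sym. Qed.

Lemma orbit_trans v u w :
  dual_orbit u v -> dual_orbit v w -> dual_orbit u w.
Proof. exact: rst_trans. Qed.

Lemma orbit_residue z u : dual_orbit u (residue z u).
Proof. by apply: rst_step; exists z. Qed.

Lemma orbit_eval u v :
  dual_orbit u v -> aleshin_eval u = 1 <-> aleshin_eval v = 1.
Proof.
elim=> {u v} [u v [z ->]|//|u v _ ->|u v w _ -> _ ->] //.
exact: eval_residue.
Qed.

Lemma reduced_residue z u : reduced (residue z u) = reduced u.
Proof.
rewrite /reduced; elim: u z => [//|l [//|m u] IHu] z.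
have /= IHz := IHu (leave z l); rewrite /= {}IHz; congr (_ && _).
by case: l m z {IHu} => [[] []] [[] []] [].
Qed.

Lemma orbit_reduced u v : dual_orbit u v -> reduced u = reduced v.
Proof.
elim=> {u v} [u v [z ->]|//|u v _ ->|u v w _ -> _ ->] //.
by rewrite reduced_residue.
Qed.

Lemma residue_rcons z u l :
  residue z (rcons u l) = rcons (residue z u) (section (leave_word z u) l).
Proof. by elim: u z => //= m u IHu z; rewrite IHu. Qed.

(** At a fixed bit and sign, [section] permutes the states; [rho] composes such permutations and
    their inverses along a chain from [u] to [v]. *)
Lemma orbit_rcons e u v : dual_orbit u v ->
  exists2 rho, bijective rho &
    forall q, dual_orbit (rcons u (q, e)) (rcons v (rho q, e)).
Proof.
elim=> {u v} [u v [z ->]|u|u v _ [rho [rho' rhoK rho'K] IH]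
             |u v w _ [rho rhoB IH] _ [tau tauB IH']].
- exists (fun q => (section (leave_word z u) (q, e)).1) => [|q].
    by apply: injF_bij; case: (leave_word z u) e => [] [] [] [].
  by have := orbit_residue z (rcons u (q, e)); rewrite residue_rcons.
- by exists id => [|q]; [exists id | exact: orbit_refl].
- exists rho' => [|q]; first by exists rho.
  by apply: orbit_sym; rewrite -{2}(rho'K q).
- exists (tau \o rho) => [|q]; first exact: bij_comp.
  exact: orbit_trans (IH q) (IH' (rho q)).
Qed.

Lemma orbit_cons e u v : dual_orbit u v ->
  exists2 rho, bijective rho &
    forall q, dual_orbit ((q, e) :: u) ((rho q, e) :: v).
Proof.
elim=> {u v} [u v [z ->]|u|u v _ [rho [rho' rhoK rho'K] IH]
             |u v w _ [rho rhoB IH] _ [tau tauB IH']].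
(* The starting bit depends on [q]: it is the one that the first letter turns into [z], so that [u]
   is always read from [z]. *)
- exists (fun q => (section (leave z (q, e)) (q, e)).1) => [|q].
    by apply: injF_bij; case: z e => [] [] [] [].
  have := orbit_residue (leave z (q, e)) ((q, e) :: u); rewrite /=.
  by have -> : leave (leave z (q, e)) (q, e) = z by case: q z => [] [].
- by exists id => [|q]; [exists id | exact: orbit_refl].
- exists rho' => [|q]; first by exists rho.
  by apply: orbit_sym; rewrite -{2}(rho'K q).
- exists (tau \o rho) => [|q]; first exact: bij_comp.
  exact: orbit_trans (IH q) (IH' (rho q)).
Qed.

Definition swap_ab q := match q with Qa => Qb | Qb => Qa | Qc => Qc end.
Definition swap_bc q := match q with Qa => Qa | Qb => Qc | Qc => Qb end.
Definition swap_ac q := match q with Qa => Qc | Qb => Qb | Qc => Qa end.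

Definition relabel (f : aleshin_state -> aleshin_state) u : seq letter :=
  [seq (f l.1, l.2) | l <- u].

(** [Qa] and [Qb] both flip the bit and have each other's transitions at the opposite bit, so
    swapping them amounts to starting from the other bit. *)
Lemma orbit_swap_ab u : dual_orbit u (relabel swap_ab u).
Proof.
have swapE z : residue z (relabel swap_ab u) = residue (~~ z) u.
  by elim: u z => //= -[q e] u IHu z; rewrite IHu; case: q z e => [] [] [].
apply: orbit_trans (orbit_residue true u) _.
by rewrite -(swapE false); apply/orbit_sym/orbit_residue.
Qed.

(** The sections of a letter at the two bits differ by the exchange of [Qb] and [Qc], and
    complementary bits stay complementary along a word. *)
Lemma orbit_swap_bc u : dual_orbit u (relabel swap_bc u).
Proof.
have swapE z v : relabel swap_bc (residue z v) = residue (~~ z) v.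
  by elim: v z => //= -[q e] v IHv z; rewrite IHv; case: q z e => [] [] [].
have [v <-] := residue_surj true u; rewrite swapE.
exact: orbit_trans (orbit_sym (orbit_residue _ _)) (orbit_residue _ _).
Qed.

Lemma orbit_swap_ac u : dual_orbit u (relabel swap_ac u).
Proof.
have -> : relabel swap_ac u = relabel swap_bc (relabel swap_ab (relabel swap_bc u)).
  by rewrite /relabel -!map_comp; apply: eq_map => -[[] e].
apply: orbit_trans (orbit_swap_bc _) _.
exact: orbit_trans (orbit_swap_ab _) (orbit_swap_bc _).
Qed.

(* [residue z] followed by the exchange of Qa and Qc; see [orbit_switch]. *)
Fixpoint switch z u : seq letter :=
  if u is l :: u' then
    (if z (+) l.2 then swap_ab l.1 else l.1, l.2) :: switch (leave z l) u'
  else [::].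

Lemma orbit_switch z u : dual_orbit u (switch z u).
Proof.
have residueE : residue z u = relabel swap_ac (switch z u).
  by elim: u z => //= -[q e] u IHu z; rewrite IHu; case: q z e => [] [] [].
apply: orbit_trans (orbit_residue z u) _; rewrite residueE.
exact/orbit_sym/orbit_swap_ac.
Qed.

Lemma switch_rcons z u l :
  switch z (rcons u l) = rcons (switch z u)
    (if leave_word z u (+) l.2 then swap_ab l.1 else l.1, l.2).
Proof. by elim: u z => //= m u IHu z; rewrite IHu. Qed.

(** * Transitivity on reduced words of a given sign pattern *)

(** Serves where a letter must differ from the previous one [q] and must flip the bit, which
    excludes [Qc]. *)
Definition other q := if q is Qa then Qb else Qa.

(* A continuation of the letter [(q, e)] fixed by [switch (~~ e)]: the state of
   [switch] at a letter (with its sign added) is [true] exactly when the sign is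
   that of the previous letter, and there the letter is Qc. *)
Fixpoint fill q e es : seq letter :=
  if es is e' :: es' then
    let q' := if e == e' then Qc else other q in (q', e') :: fill q' e' es'
  else [::].

Lemma unzip2_fill q e es : unzip2 (fill q e es) = es.
Proof. by elim: es q e => //= e' es IHes q e; rewrite IHes. Qed.

Lemma fill_rcons q e es :
  fill q e (rcons es (last e es)) = rcons (fill q e es) (Qc, last e es).
Proof. by elim: es q e => /= [|e' es IHes] q e; rewrite ?eqxx // IHes. Qed.

Lemma reduced_fill q e es : path (@composable _) (q, e) (fill q e es).
Proof.
elim: es q e => //= e' es IHes q e; rewrite IHes andbT.
by case: q e e' => [] [] [].
Qed.

Lemma switch_fill q e es : switch (~~ e) (fill q e es) = fill q e es.
Proof.
elim: es q e => //= e' es IHes q e; congr (_ :: _).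
  by case: q e e' => [] [] [].
by rewrite -{2}IHes; congr switch; case: q e e' => [] [] [].
Qed.

Lemma leave_fill q e es : leave_word (~~ e) (fill q e es) = ~~ last e es.
Proof.
elim: es q e => //= e' es IHes q e; rewrite -(IHes (if e == e' then Qc else other q)).
by congr leave_word; case: q e e' => [] [] [].
Qed.

(** Only a sign change makes [fill] depend on [q]; there [fill Qc e es] begins with [Qa], so the
    path condition gives [q != Qa], and [other q] is [Qa] too. *)
Lemma fill_eq q e es :
  path (@composable _) (q, e) (fill Qc e es) -> fill q e es = fill Qc e es.
Proof. by case: es => //= e' es; case: q e e' => [] [] []. Qed.

Lemma orbit_fill_rcons q e es (u := (q, e) :: fill q e es) :
  dual_orbit (rcons u (Qa, last e es)) (rcons u (Qb, last e es)).
Proof.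
(* From this bit, [switch] fixes the first letter and enters the filler with [~~ e]; the appended
   letter repeats the last sign and is therefore swapped. *)
pose z := if q is Qc then ~~ e else e.
have leave_z : leave z (q, e) = ~~ e by rewrite /z; case: q {u z} e => [] [].
have z_fix : (if z (+) e then swap_ab q else q) = q.
  by rewrite /z; case: q {u z leave_z} e => [] [].
have := orbit_switch z (rcons u (Qa, last e es)).
rewrite switch_rcons /= leave_z z_fix switch_fill leave_fill.
by case: (last e es).
Qed.

(* A word ending in [Qc] along which [switch e] stays in the state [false]. Here
   [q] is only the previous letter, to be avoided. *)
Fixpoint prefill q e es : seq letter :=
  if es is e' :: es' then
    let q' := if e == e' then Qc else other q in (q', e) :: prefill q' e' es'
  else [:: (Qc, e)].

Lemma unzip2_prefill q e es : unzip2 (prefill q e es) = e :: es.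
Proof. by elim: es q e => //= e' es IHes q e; rewrite IHes. Qed.

Lemma reduced_prefill q e es : reduced (prefill q e es).
Proof.
rewrite /reduced.
have prefill_path d : (d == e) || (q != Qc) ->
    path (@composable _) (q, d) (prefill q e es).
  elim: es q d e => [|e' es IHes] q d e /=; first by case: q d e => [] [] [].
  move=> dq; rewrite IHes ?andbT; first by case: q d e e' dq => [] [] [] [].
  by case: q e e' {dq} => [] [] [].
by have /path_sorted := prefill_path e (introT orP (or_introl (eqxx e))).
Qed.

Lemma last_prefill l q e es : last l (prefill q e es) = (Qc, last e es).
Proof. by elim: es l q e => //= e' es IHes l q e; rewrite IHes. Qed.

Lemma switch_prefill q e es : switch e (prefill q e es) = prefill q e es.
Proof.
elim: es q e => [|e' es IHes] q e /=; first by rewrite addbb.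
rewrite addbb -{2}IHes; congr (_ :: switch _ _).
by case: q e e' => [] [] [].
Qed.

Lemma leave_prefill q e es : leave_word e (prefill q e es) = last e es.
Proof.
elim: es q e => //= e' es IHes q e; rewrite -(IHes (if e == e' then Qc else other q)).
by congr leave_word; case: q e e' => [] [] [].
Qed.

Lemma orbit_prefill_rcons q e es (u := prefill q e es) :
  dual_orbit (rcons u (Qa, ~~ last e es)) (rcons u (Qb, ~~ last e es)).
Proof.
have := orbit_switch e (rcons u (Qa, ~~ last e es)).
by rewrite switch_rcons switch_prefill leave_prefill addbN addbb.
Qed.

Lemma orbit_single q p e : dual_orbit [:: (q, e)] [:: (p, e)].
Proof.
suff toc r : dual_orbit [:: (r, e)] [:: (Qc, e)].
  exact: orbit_trans (toc q) (orbit_sym (toc p)).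
case: r; [exact: (orbit_swap_ac [:: _])|exact: (orbit_swap_bc [:: _])|].
exact: orbit_refl.
Qed.

(* The fibres over [u] and [v] carry the same orbit partition; if [Qc] is a
   singleton class on one side, it is one on the other side as well. *)
Lemma orbit_rcons_Qc e u v : dual_orbit u v ->
    dual_orbit (rcons u (Qa, e)) (rcons u (Qb, e)) ->
    dual_orbit (rcons v (Qa, e)) (rcons v (Qb, e)) ->
  dual_orbit (rcons u (Qc, e)) (rcons v (Qc, e)).
Proof.
move=> /(orbit_rcons e)[rho /bij_inj rho_inj uv] u_ab v_ab.
have v_a q : q != Qc -> dual_orbit (rcons v (q, e)) (rcons v (Qa, e)).
  by case: q => // _; [exact: orbit_refl | exact: orbit_sym].
have [rho_c|rho_c] := eqVneq (rho Qc) Qc; first by have := uv Qc; rewrite rho_c.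
apply: orbit_trans (uv Qc) (orbit_trans (v_a _ rho_c) (orbit_sym _)).
(* Now [Qc] is the image of [Qa] or [Qb], so transporting [u_ab] joins it to the class of [Qa] and
   [Qb] over [v]. *)
have rho_ab : dual_orbit (rcons v (rho Qa, e)) (rcons v (rho Qb, e)).
  exact: orbit_trans (orbit_sym (uv Qa)) (orbit_trans u_ab (uv Qb)).
have [rho_a|rho_a] := eqVneq (rho Qa) Qc.
  move: rho_ab; rewrite rho_a => /orbit_trans; apply; apply: v_a.
  by rewrite -rho_a (inj_eq rho_inj).
have [rho_b|rho_b] := eqVneq (rho Qb) Qc.
  by move: rho_ab; rewrite rho_b => /orbit_sym/orbit_trans; apply; apply: v_a.
have : rho Qa != rho Qb by rewrite (inj_eq rho_inj).
have : rho Qa != rho Qc by rewrite (inj_eq rho_inj).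
have : rho Qb != rho Qc by rewrite (inj_eq rho_inj).
by move: rho_a rho_b rho_c; case: (rho Qa); case: (rho Qb); case: (rho Qc).
Qed.

Lemma reduced_rcons u l :
  reduced (rcons u l) = reduced u && composable (last l u) l.
Proof.
by case: u => [|k u]; rewrite /reduced /= ?rcons_path // /composable eqxx.
Qed.

Definition transitive_pattern (es : seq bool) :=
  forall u v, reduced u -> reduced v -> unzip2 u = es -> unzip2 v = es ->
    dual_orbit u v.

(** Once the prefix is moved to a word ending in [Qc], reducedness leaves only [Qa] and [Qb] for the
    last letter, and [orbit_prefill_rcons] joins these. *)
Lemma transitive_change e es :
  transitive_pattern (e :: es) ->
  transitive_pattern (rcons (e :: es) (~~ last e es)).
Proof.
move=> IH; pose v := prefill Qa e es.
suff to_v u : reduced u -> unzip2 u = rcons (e :: es) (~~ last e es) ->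
    dual_orbit u (rcons v (Qa, ~~ last e es)).
  move=> u w u_red w_red u_s w_s.
  exact: orbit_trans (to_v u _ _) (orbit_sym (to_v w _ _)).
case/lastP: u => [//|u [q d]] uq_red.
rewrite /unzip2 map_rcons => /rcons_inj[u_s /= d_e].
have := uq_red; rewrite reduced_rcons => /andP[u_red _].
have [rho _ uv] := orbit_rcons d
  (IH u v u_red (reduced_prefill _ _ _) u_s (unzip2_prefill _ _ _)).
move: uq_red; rewrite (orbit_reduced (uv q)) reduced_rcons last_prefill.
have := uv q; rewrite d_e; case: (rho q) => u_v /andP[_].
- by move=> _; exact: u_v.
- by move=> _; exact: orbit_trans u_v (orbit_sym (orbit_prefill_rcons _ _ _)).
- by case: (last e es).
Qed.

(* By transitivity on suffixes only the first letter of a word remains to be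
   adjusted; transitivity on prefixes and [orbit_rcons_Qc] then do this. *)
Lemma transitive_repeat e es :
  transitive_pattern (e :: es) -> transitive_pattern (rcons es (last e es)) ->
  transitive_pattern (rcons (e :: es) (last e es)).
Proof.
move=> IHl IHr; pose v := fill Qc e es.
suff to_v u : reduced u -> unzip2 u = rcons (e :: es) (last e es) ->
    dual_orbit u (rcons ((Qc, e) :: v) (Qc, last e es)).
  move=> u w u_red w_red u_s w_s.
  exact: orbit_trans (to_v u _ _) (orbit_sym (to_v w _ _)).
case: u => [//|[q d] u] qu_red [d_e u_s]; rewrite {d}d_e in qu_red *.
have v_red := reduced_fill Qc e (rcons es (last e es)).
have [rho _ uv] : exists2 rho, bijective rho &
    forall q, dual_orbit ((q, e) :: u) ((rho q, e) :: rcons v (Qc, last e es)).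
  apply: orbit_cons; rewrite -fill_rcons; apply: IHr => //.
  - exact: path_sorted qu_red.
  - exact: path_sorted v_red.
  - exact: unzip2_fill.
have := esym (orbit_reduced (uv q)).
rewrite qu_red /reduced /= rcons_path => /andP[p_path _].
apply: orbit_trans (uv q) _.
(* Reducedness makes [v] the filler of [(p, e)] as well, so [orbit_fill_rcons] applies over both
   prefixes. *)
move: (rho q) p_path => p p_path; have p_fill := fill_eq p_path.
apply: (@orbit_rcons_Qc _ ((p, e) :: v) ((Qc, e) :: v)).
- apply: IHl => //; [exact: reduced_fill | |]; by rewrite /= unzip2_fill.
- by have := orbit_fill_rcons p e es; rewrite p_fill.
- exact: orbit_fill_rcons.
Qed.

Lemma transitive_all es : transitive_pattern es.
Proof.
elim: {es}(size es) {-2}es (erefl (size es)) => [|n IHn] es.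
  move=> /size0nil-> [|//] [|//] _ _ _ _; exact: orbit_refl.
case: es => [//|e es] [es_n]; case/lastP: es es_n => [_|es d].
  move=> [//|[q d] [|//]] [//|[p d'] [|//]] _ _ [->] [->].
  exact: orbit_single.
rewrite size_rcons => es_n; have IHl : transitive_pattern (e :: es) by apply: IHn.
rewrite -rcons_cons; have [->|/negPf d_last] := eqVneq d (last e es).
  by apply: transitive_repeat => //; apply: IHn; rewrite size_rcons.
have -> : d = ~~ last e es by move: d_last; case: d; case: (last e es).
exact: transitive_change.
Qed.

Lemma aleshin_eval_nontrivial u :
  reduced u -> u != [::] -> aleshin_eval u <> 1.
Proof.
case: u => [//|[q0 e] u] u_red _ u1; pose es := unzip2 u.
have parity q z : leave_word z ((q, e) :: fill q e es) = z.
  have orb : dual_orbit ((q0, e) :: u) ((q, e) :: fill q e es).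
    apply: transitive_all (erefl _) _ => //; first exact: reduced_fill.
    by rewrite /= unzip2_fill.
  have := eval_cons ((q, e) :: fill q e es) z [::].
  by rewrite (proj1 (orbit_eval orb) u1) => -[].
(* Started at [~~ e] and [e] respectively, both words enter their filler with [~~ e] and leave it
   with [~~ last e es], so they cannot both preserve the bit. *)
have := parity Qc (~~ e); have := parity Qa e.
by rewrite /= /leave /= !leave_fill => -> /esym; case: e {u1 u_red es parity}.
Qed.

Theorem theorem1p1 : freely_generate aleshin_aut.
Proof. exact: freely_generate_reduced aleshin_eval_nontrivial. Qed.
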